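(* Assume that $\lambda_*$ is an eigenvalue of a self-adjoint discrete Sturm-Liouville problem $(\boldsymbol{\omega},\mathbf{S}_{\alpha,\beta})$ with $\mathbf{S}_{\alpha,\beta}\in\mathcal{B}_S$. Let $y=\{y_n\}_{n=0}^{N+1}$ be a normalized eigenfunction for $\lambda_*$, and $\Lambda$ the continuous eigenvalue branch over $\mathcal{B}_S$ (with $\boldsymbol{\omega}$ fixed) through $\lambda_*$; write $\Lambda(\alpha,\beta)=\Lambda(\mathbf{S}_{\alpha,\beta})$. Then its derivatives are given by $$\Lambda'_\alpha(\alpha,\beta)=-|y_0|^2-|f_0\Delta y_0|^2,\qquad \Lambda'_\beta(\alpha,\beta)=|y_N|^2+|f_N\Delta y_N|^2.$$
   Context: $N\ge2$ is an integer, $\Delta y_n=y_{n+1}-y_n$, $\nabla y_n=y_n-y_{n-1}$. A discrete Sturm-Liouville equation $-\nabla(f_n\Delta y_n)+q_ny_n=\lambda w_ny_n$, $1\le n\le N$, is identified with $\boldsymbol{\omega}=(1/f,q,w)$; for a self-adjoint problem $\boldsymbol{\omega}\in\Omega_N^{\mathbb{R},+}$, i.e. $f_0,\dots,f_N$ are real and nonzero, $q_1,\dots,q_N$ real, and $w_1,\dots,w_N>0$. $\mathcal{B}_S$ is the space of separated self-adjoint boundary conditions, each of which can be written as $$\mathbf{S}_{\alpha,\beta}:\quad \cos\alpha\, y_0-\sin\alpha\, (f_0\Delta y_0)=0,\qquad \cos\beta\, y_N-\sin\beta\,(f_N\Delta y_N)=0,$$ with $\alpha\in[0,\pi)$, $\beta\in(0,\pi]$.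 $\mathcal{B}_S$ has the topology induced from the quotient space of rank-$2$ complex $2\times4$ coefficient matrices modulo left multiplication by $GL(2,\mathbb{C})$; the displayed formula defines $\mathbf{S}_{\alpha,\beta}$ for all real $\alpha,\beta$, with period $\pi$ in each variable, and at the endpoint values of $\alpha$ or $\beta$ derivatives are understood via this extension. A number $\lambda$ is an eigenvalue of the problem if there is a nonzero complex sequence $y=\{y_n\}_{n=0}^{N+1}$ (an eigenfunction) satisfying both the equation and the boundary condition. For problems in $\Omega_N^{\mathbb{R},+}\times\mathcal{B}_S$ all eigenvalues are real and simple (simple zeros of the characteristic polynomial $\Gamma(\lambda)=\det(A+B\Phi_N(\lambda))$, where the boundary condition is written $A(y_0,f_0\Delta y_0)^t+B(y_N,f_N\Delta y_N)^t=0$ and $\Phi_N(\lambda)=\begin{pmatrix}\phi_N&\psi_N\\ f_N\Delta\phi_N&f_N\Delta\psi_N\end{pmatrix}$ with $\phi,\psi$ the solutions satisfying $\phi_0=1,f_0\Delta\phi_0=0,\psi_0=0,f_0\Delta\psi_0=1$). An eigenfunction is normalized if $\sum_{n=1}^Nw_n|y_n|^2=1$. The continuous eigenvalue branch over $\mathcal{B}_S$ through $\lambda_*$: a continuous real function $\Lambda$ on a connected neighborhood of $\mathbf{S}_{\alpha,\beta}$ in $\mathcal{B}_S$ with $\Lambda(\mathbf{S}_{\alpha,\beta})=\lambda_*$ such that $\Lambda(\mathbf{S})$ is an eigenvalue of $(\boldsymbol{\omega},\mathbf{S})$ for each $\mathbf{S}$ in that neighborhood (it exists and is locally unique). *)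

(* Defs.v *)
From HB Require Import structures.
From mathcomp Require Import all_boot all_order all_algebra generic_quotient.
From mathcomp Require Import all_classical all_reals all_analysis.
From mathcomp Require Import complex.

Set Implicit Arguments.
Unset Strict Implicit.
Unset Printing Implicit Defensive.

Import Order.TTheory GRing.Theory Num.Theory.
Import numFieldNormedType.Exports.

Local Open Scope classical_set_scope.
Local Open Scope ring_scope.
Local Open Scope complex_scope.

(* Ascribing [R[i]] to [numClosedFieldType] gives access to its norm topology,
   which is only declared on the sorts of abstract numeric fields. *)
Notation cplx R := ((R[i] : numClosedFieldType) : Type).

(* A pair (A, B) of 2 x 2 matrices is the 2 x 4 matrix [row_mx A B]. *)
Definition bc_matrix (R : realType) : Type :=
  set_type [set M : 'M[cplx R]_(2, 2 + 2) | \rank M = 2%N].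
HB.instance Definition _ (R : realType) := Topological.on (bc_matrix R).

Definition bc_mx (R : realType) (M : bc_matrix R) : 'M[cplx R]_(2, 2 + 2) :=
  \val M.

Definition bc_equiv (R : realType) (M M' : bc_matrix R) : bool :=
  `[< exists2 T : 'M[cplx R]_2, T \in unitmx & bc_mx M' = T *m bc_mx M >].

Lemma bc_equiv_refl (R : realType) : reflexive (@bc_equiv R).
Proof. by move=> M; apply/asboolP; exists 1%:M; rewrite ?unitmx1 ?mul1mx. Qed.

Lemma bc_equiv_sym (R : realType) : symmetric (@bc_equiv R).
Proof.
suff H M M' : @bc_equiv R M M' -> bc_equiv M' M.
  by move=> M M'; apply/idP/idP; exact: H.
move=> /asboolP[T uT e]; apply/asboolP; exists (invmx T).
  by rewrite unitmx_inv.
by rewrite e mulKmx.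
Qed.

Lemma bc_equiv_trans (R : realType) : transitive (@bc_equiv R).
Proof.
move=> M' M M'' /asboolP[T uT e1] /asboolP[T' uT' e2]; apply/asboolP.
by exists (T' *m T); rewrite ?unitmx_mul ?uT ?uT' // e2 e1 mulmxA.
Qed.

Canonical bc_equivRel (R : realType) :=
  EquivRel (@bc_equiv R) (@bc_equiv_refl R) (@bc_equiv_sym R)
    (@bc_equiv_trans R).

Local Open Scope quotient_scope.

Definition bc_space (R : realType) : Type :=
  quotient_topology {eq_quot @bc_equiv R}.
HB.instance Definition _ (R : realType) := Quotient.on (bc_space R).
HB.instance Definition _ (R : realType) := Topological.on (bc_space R).

Definition sep_row (R : realType) (t : R) : 'rV[cplx R]_2 :=
  \row_(j < 2) (if j == 0 then cos t else - sin t)%:C.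

Definition sep_mx (R : realType) (a b : R) : 'M[cplx R]_(2, 2 + 2) :=
  @block_mx _ 1 1 2 2 (sep_row a) 0 0 (sep_row b).

Lemma sep_row_normalized (R : realType) (t : R) :
  sep_row t *m (sep_row t)^T = 1%:M.
Proof.
apply/matrixP => i j; rewrite !ord1 !mxE big_ord_recl big_ord1 !mxE /=.
by rewrite -!rmorphM -rmorphD /= -!expr2 sqrrN cos2Dsin2.
Qed.

Lemma sep_mx_rank (R : realType) (a b : R) :
  [set M : 'M[cplx R]_(2, 2 + 2) | \rank M = 2%N] (sep_mx a b).
Proof.
apply/eqP; apply/row_freeP; exists (sep_mx a b)^T.
rewrite /sep_mx (@tr_block_mx _ 1 1 2 2) !trmx0 (@mulmx_block _ 1 1 2 2 1 1).
rewrite !mul0mx !mulmx0 !addr0 !add0r !sep_row_normalized.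
by rewrite (@scalar_mx_block _ 1 1 1).
Qed.

Definition sep_rep (R : realType) (a b : R) : bc_matrix R :=
  exist _ (sep_mx a b) (mem_set (sep_mx_rank a b)).

Definition sep_class (R : realType) (a b : R) : bc_space R :=
  \pi_(bc_space R) (sep_rep a b).

(* The ranges make [a] and [b] unique; [sep_class_sep] shows that the class
   belongs to this space for all real [a] and [b]. *)
Definition sep_bc (R : realType) : Type :=
  set_type [set S : bc_space R |
    exists a b : R, [/\ 0 <= a < pi, 0 < b <= pi & S = sep_class a b]].
HB.instance Definition _ (R : realType) := Topological.on (sep_bc R).

Lemma sep_row_shift (R : realType) (t : R) (n : nat) :
  sep_row (t + pi *+ n) = (-1) ^+ n *: sep_row t.
Proof.
apply/rowP => j; rewrite !mxE (alternatingn (@cosDpi R)) (alternatingn (@sinDpi R)).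
rewrite -mulrN; case: ifP => _; by rewrite rmorphM /= rmorphXn /= rmorphN1.
Qed.

Lemma sep_row_shiftN (R : realType) (t : R) (n : nat) :
  sep_row (t - pi *+ n) = (-1) ^+ n *: sep_row t.
Proof.
by rewrite -{2}[t](subrK (pi *+ n)) sep_row_shift scalerA -expr2 sqrr_sign scale1r.
Qed.

Lemma sep_row_reduce (R : realType) (t : R) :
  exists2 a : R, 0 <= a < pi &
    exists n : nat, sep_row t = (-1) ^+ n *: sep_row a.
Proof.
have pi0 : 0 < pi :> R := pi_gt0 R.
pose k := Num.floor (t / pi); pose a := t - pi *~ k.
exists a.
  have /andP[k1 k2] := floor_itv (t / pi).
  rewrite /a subr_ge0 ltrBlDl -[X in pi *~ k + X]mulr1z -mulrzDr.
  by rewrite -![pi *~ _]mulrzl -ler_pdivlMr // -ltr_pdivrMr // k1.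
rewrite (_ : sep_row t = sep_row (a + pi *~ k)); last by rewrite subrK.
move: (a) (k) => a' [] n; first by exists n; exact: sep_row_shift.
by exists n.+1; exact: sep_row_shiftN.
Qed.

Lemma sep_class_sign (R : realType) (a b a' b' : R) (m n : nat) :
  sep_row a = (-1) ^+ m *: sep_row a' -> sep_row b = (-1) ^+ n *: sep_row b' ->
  sep_class a b = sep_class a' b'.
Proof.
move=> ea eb; apply/esym/eqmodP/asboolP.
exists (@block_mx _ 1 1 1 1 ((-1) ^+ m)%:M 0 0 ((-1) ^+ n)%:M).
  by rewrite unitmxE (@det_ublock _ 1 1) !det_scalar1 unitrM !unitrX ?unitrN1.
rewrite /bc_mx /= /sep_mx (@mulmx_block _ 1 1 1 1 2 2).
by rewrite !mul0mx !mulmx0 !addr0 !add0r !mul_scalar_mx ea eb.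
Qed.

Lemma sep_class_sep (R : realType) (a b : R) :
  [set S : bc_space R |
    exists a' b' : R, [/\ 0 <= a' < pi, 0 < b' <= pi & S = sep_class a' b']]
  (sep_class a b).
Proof.
have [a' Ha [m Em]] := sep_row_reduce a; have [b' Hb [n En]] := sep_row_reduce b.
case/andP: Hb => [b0 b1].
have [b'0|b'0] := eqVneq b' 0.
  exists a', pi; split => //; first by rewrite pi_gt0 lexx.
  apply: (sep_class_sign (n := n.+1) Em); rewrite En b'0.
  rewrite -[pi]add0r -[X in 0 + X]mulr1n sep_row_shift scalerA expr1 exprS.
  by rewrite mulN1r mulrN1 opprK.
exists a', b'; split=> //; last exact: sep_class_sign Em En.
by rewrite lt_def b'0 b0 ltW.
Qed.

Definition sep (R : realType) (a b : R) : sep_bc R :=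
  exist _ (sep_class a b) (mem_set (sep_class_sep a b)).

(* Sequences indexed by 0..N, 1..N or 0..N+1 are functions on [nat]; only their
   values on the relevant range are ever constrained or used. *)

Definition self_adjoint_coeffs (R : realType) (N : nat) (f q w : nat -> R) :
    Prop :=
  (forall n, (n <= N)%N -> f n != 0) /\
  (forall n, (1 <= n <= N)%N -> 0 < w n).

Definition quasi_diff (R : realType) (f : nat -> R) (y : nat -> cplx R)
    (n : nat) : cplx R :=
  (f n)%:C * (y n.+1 - y n).

Definition sl_equation (R : realType) (N : nat) (f q w : nat -> R)
    (lam : cplx R) (y : nat -> cplx R) : Prop :=
  forall n, (1 <= n <= N)%N ->
    - (quasi_diff f y n - quasi_diff f y n.-1) + (q n)%:C * y n =
    lam * (w n)%:C * y n.

Definition boundary_vec (R : realType) (f : nat -> R) (y : nat -> cplx R)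
    (n : nat) : 'cV[cplx R]_2 :=
  \col_(i < 2) (if i == 0 then y n else quasi_diff f y n).

Definition satisfies_mx (R : realType) (N : nat) (f : nat -> R)
    (M : bc_matrix R) (y : nat -> cplx R) : Prop :=
  lsubmx (bc_mx M) *m boundary_vec f y 0 +
  rsubmx (bc_mx M) *m boundary_vec f y N = 0.

(* Independent of the chosen representative: see [satisfies_bc_pi]. *)
Definition satisfies_bc (R : realType) (N : nat) (f : nat -> R)
    (S : bc_space R) (y : nat -> cplx R) : Prop :=
  satisfies_mx N f (repr S) y.

Definition sl_eigenfunction (R : realType) (N : nat) (f q w : nat -> R)
    (S : bc_space R) (lam : cplx R) (y : nat -> cplx R) : Prop :=
  [/\ exists2 n, (n <= N.+1)%N & y n != 0,
      sl_equation N f q w lam y &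
      satisfies_bc N f S y].

Definition sl_eigenvalue (R : realType) (N : nat) (f q w : nat -> R)
    (S : bc_space R) (lam : cplx R) : Prop :=
  exists y, sl_eigenfunction N f q w S lam y.

Definition normalized (R : realType) (N : nat) (w : nat -> R)
    (y : nat -> cplx R) : Prop :=
  \sum_(1 <= n < N.+1) w n * Normc.normc (y n) ^+ 2 = 1.

(* [L] is total on [sep_bc R], but only its values on [U] are constrained. *)
Definition sl_eigenvalue_branch (R : realType) (N : nat) (f q w : nat -> R)
    (S0 : sep_bc R) (lam : cplx R) (U : set (sep_bc R)) (L : sep_bc R -> R) :
    Prop :=
  [/\ nbhs S0 U,
      connected U,
      {within U, continuous L},
      (L S0)%:C = lam &
      forall S, U S -> sl_eigenvalue N f q w (\val S) (L S)%:C].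

Lemma satisfies_bc_pi (R : realType) (N : nat) (f : nat -> R)
    (M : bc_matrix R) (y : nat -> cplx R) :
  satisfies_bc N f (\pi_(bc_space R) M) y <-> satisfies_mx N f M y.
Proof.
have H M1 M2 : bc_equiv M1 M2 -> satisfies_mx N f M1 y -> satisfies_mx N f M2 y.
  move=> /asboolP[T _ e] h; rewrite /satisfies_mx e.
  by rewrite -mulmx_lsub -mulmx_rsub -!mulmxA -mulmxDr h mulmx0.
have e : bc_equiv (repr (\pi_(bc_space R) M)) M by apply/eqmodP; rewrite reprK.
by split; apply: H => //; rewrite bc_equiv_sym.
Qed.

Lemma satisfies_sep (R : realType) (N : nat) (f : nat -> R) (a b : R)
    (y : nat -> cplx R) :
  satisfies_bc N f (sep_class a b) y <->
  (cos a)%:C * y 0%N - (sin a)%:C * quasi_diff f y 0 = 0 /\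
  (cos b)%:C * y N - (sin b)%:C * quasi_diff f y N = 0.
Proof.
rewrite satisfies_bc_pi /satisfies_mx /bc_mx /= /sep_mx.
rewrite (@block_mxEh _ 1 1 2 2) row_mxKl row_mxKr !(@mul_col_mx _ 1 1).
rewrite !mul0mx (@add_col_mx _ 1 1) addr0 add0r.
have E t n : (sep_row t *m boundary_vec f y n) 0 0 =
    (cos t)%:C * y n - (sin t)%:C * quasi_diff f y n.
  by rewrite mxE big_ord_recl big_ord1 !mxE /= rmorphN mulNr.
rewrite -!E; split=> [/eqP|[h1 h2]].
  by rewrite (@col_mx_eq0 _ 1 1) => /andP[/eqP-> /eqP->]; rewrite !mxE.
apply/eqP; rewrite (@col_mx_eq0 _ 1 1); apply/andP.
by split; apply/eqP/matrixP => i j; rewrite !ord1 [in RHS]mxE.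
Qed.

(* Main.v *)
Require Import Defs.
From HB Require Import structures.
From mathcomp Require Import all_boot all_order all_algebra generic_quotient.
From mathcomp Require Import all_classical all_reals all_analysis.
From mathcomp Require Import complex.
From mathcomp Require Import ring lra.

Set Implicit Arguments.
Unset Strict Implicit.
Unset Printing Implicit Defensive.

Import Order.TTheory GRing.Theory Num.Theory.
Import numFieldNormedType.Exports.

Local Open Scope classical_set_scope.
Local Open Scope ring_scope.
Local Open Scope complex_scope.

(** At an angle [th] the condition [cos th * y_0 = sin th * (f_0 Delta y_0)]
    says that the initial data of [y] is a multiple of [(sin th, cos th)].
    Hence, for real [l], every eigenfunction of the problem with angles [s, t]
    and eigenvalue [l] is [C] times the real solution [v] shot from
    [(sin s, cos s)], and its end data is a multiple [d] of [(sin t, cos t)]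
    ([eigenfunction_shoot], [proportional_to_angle]).

    Let [s z] and [t z] be a path of angles, let [M z] be the value of the
    branch along it, and compare the shot solution [v z] with [v x].  The
    Lagrange identity ([lagrange_identity]) gives the increment of their
    Casoratian over [0..N] as a weighted sum, while the boundary conditions
    give the Casoratian at each end as the sine of a difference of angles.
    The result is the exact relation
      [(M z - M x) * sigma z =
         d x * d z * sin (t z - t x) - sin (s z - s x)],
    where [sigma z] is the [w]-weighted sum of the products of the first
    components of [v x] and [v z].

    The branch is continuous, so [sigma] and [d] are continuous at [x], and
    normalization gives [sigma x = |C| ^- 2].  Dividing by [sigma z] writes
    [M z - M x] as continuous factors times sines that vanish at [x], and a
    product of this kind is differentiable with no differentiability of the
    continuous factor ([is_derive_mul_vanishing]).  Thus
      [M' = |C| ^+ 2 * (d ^+ 2 * t' - s')],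
    where [|C| ^+ 2] is [|y_0| ^+ 2 + |f_0 Delta y_0| ^+ 2] and
    [|C| ^+ 2 * d ^+ 2] is the same expression at [N].  The partial
    derivatives are the cases where one of the two angles stays constant. *)

(** * Continuity of the boundary condition in its angles *)

Lemma real_complex_continuous (R : realType) :
  continuous (fun x : R => x%:C : cplx R).
Proof.
move=> x; apply/(@cvgrPdist_lt (R[i] : numClosedFieldType)) => e e0.
have [e' e'0 ->] : exists2 e' : R, 0 < e' & e = e'%:C.
  (* a positive complex number is real *)
  case: e e0 => u v; rewrite ltcE /= => /andP[/eqP -> u0].
  by exists u.
have : \forall t \near x, `|x - t| < e' by exact: nbhsx_ballx.
apply: filterS => t xt.
rewrite -rmorphB /= normc_def /= expr0n addr0 sqrtr_sqr.
by rewrite ltcR.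
Qed.

(** A subset has the initial topology of its inclusion, so convergence can be
    tested in the ambient space. *)
Lemma cvg_set_type (T : topologicalType) (D : set T) (X : Type)
    (F : set_system X) (FF : Filter F) (g : X -> D) (p : D) :
  (fun z => set_val (g z)) @ F --> set_val p -> g @ F --> p.
Proof.
move=> cg A [_ [[B oB <-] Bp] sBA].
have : F [set z | B (set_val (g z))].
  by apply: (cg B); apply: open_nbhs_nbhs; split.
by apply: (@filterS _ F FF) => z Bz; apply: sBA.
Qed.

Lemma cvg_mx_entries (T : topologicalType) (m n : nat) (X : Type)
    (F : set_system X) (FF : Filter F) (g : X -> 'M[T]_(m, n))
    (M : 'M[T]_(m, n)) :
  (forall i j, (fun z => g z i j) @ F --> M i j) -> g @ F --> M.
Proof.
move=> cg A [P nP sPA].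
have near_entry (ij : 'I_m * 'I_n) : F [set z | P ij.1 ij.2 (g z ij.1 ij.2)].
  exact: (cg ij.1 ij.2 _ (nP ij.1 ij.2)).
have := filter_forall FF near_entry.
by apply: (@filterS _ F FF) => z Pz; apply: sPA => i j; exact: (Pz (i, j)).
Qed.

Lemma sep_row_continuous_along (R : realType) (r : R -> R) (x : R) :
  {for x, continuous r} ->
  forall i j, {for x, continuous (fun z => sep_row (r z) i j : cplx R)}.
Proof.
move=> cr i j.
rewrite (_ : (fun z => _) =
    (fun z => (if j == 0 then cos (r z) else - sin (r z))%:C)); last first.
  by apply/funext => z; rewrite mxE.
suff /continuous_comp H :
    {for x, continuous (fun z => if j == 0 then cos (r z) else - sin (r z))}.
  exact: (H _ (fun x : R => x%:C : cplx R) (@real_complex_continuous R _)).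
case: (j == 0).
  by apply: continuous_comp => //; exact: continuous_cos.
by apply: continuousN; apply: continuous_comp => //; exact: continuous_sin.
Qed.

Lemma sep_mx_continuous_along (R : realType) (s t : R -> R) (x : R) :
  {for x, continuous s} -> {for x, continuous t} ->
  (fun z => sep_mx (s z) (t z)) @ x --> sep_mx (s x) (t x).
Proof.
move=> cs ct; apply: cvg_mx_entries => i j.
have ext (h h' : R -> cplx R) : h =1 h' ->
    {for x, continuous h'} -> {for x, continuous h} by move=> /funext ->.
suff : {for x, continuous (fun z => sep_mx (s z) (t z) i j : cplx R)} by [].
rewrite /sep_mx /block_mx.
case: (@split_ordP 1 1 i) => i' ->; case: (@split_ordP 2 2 j) => j' ->.
- apply: (ext _ (fun z => sep_row (s z) 0 j')).
    by move=> z; rewrite (@col_mxEu _ 1 1) (@row_mxEl _ 1 2 2) ord1.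
  exact: sep_row_continuous_along.
- apply: (ext _ (fun=> 0)); last exact: cvg_cst.
  by move=> z; rewrite (@col_mxEu _ 1 1) (@row_mxEr _ 1 2 2) mxE.
- apply: (ext _ (fun=> 0)); last exact: cvg_cst.
  by move=> z; rewrite (@col_mxEd _ 1 1) (@row_mxEl _ 1 2 2) mxE.
apply: (ext _ (fun z => sep_row (t z) 0 j')).
  by move=> z; rewrite (@col_mxEd _ 1 1) (@row_mxEr _ 1 2 2) ord1.
exact: sep_row_continuous_along.
Qed.

(** Each layer of the construction of the space of boundary conditions is
    crossed in turn: the rank-2 subset, the quotient, the separated subset. *)
Lemma sep_continuous_along (R : realType) (s t : R -> R) (x : R) :
  {for x, continuous s} -> {for x, continuous t} ->
  {for x, continuous (fun z => sep (s z) (t z))}.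
Proof.
move=> cs ct.
have crep : (fun z => sep_rep (s z) (t z)) @ x --> sep_rep (s x) (t x).
  by apply: cvg_set_type; exact: sep_mx_continuous_along.
have ccls : (fun z => sep_class (s z) (t z)) @ x --> sep_class (s x) (t x).
  move=> A /(@pi_continuous _ _ (sep_rep (s x) (t x))) nA.
  exact: (crep _ nA).
exact: cvg_set_type.
Qed.

(** * The recursion satisfied by the solutions *)

(** In terms of [(y_n, f_n Delta y_n)], with [g = 1 / f] and [c = q - l w], the
    equation is this first-order system. *)
Fixpoint shoot (K : pzRingType) (g c : nat -> K) (v : K * K) (n : nat) :
    K * K :=
  if n is m.+1 then
    let: (u, p) := shoot g c v m in
    (u + g m * p, p + c m.+1 * (u + g m * p))
  else v.

Definition casoratian (K : pzRingType) (v v' : K * K) : K :=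
  v.1 * v'.2 - v.2 * v'.1.

(** One step of the system changes the Casoratian only through the difference
    of the potentials, because the [g] terms cancel. *)
Lemma lagrange_identity (K : comPzRingType) (g c c' : nat -> K) (v v' : K * K)
    (n : nat) :
  casoratian (shoot g c v n) (shoot g c' v' n) = casoratian v v' +
  \sum_(1 <= k < n.+1)
     (c' k - c k) * (shoot g c v k).1 * (shoot g c' v' k).1.
Proof.
elim: n => [|n IH]; first by rewrite big_geq // addr0.
rewrite big_nat_recr //= addrA -IH /casoratian.
by case: (shoot g c v n) (shoot g c' v' n) => u p [u' p'] /=; ring.
Qed.

(** [(y, p)] is orthogonal to the unit vector [(c, - s)], so it equals its
    projection on [(s, c)]. *)
Lemma proportional_to_angle (K : comPzRingType) (c s y p : K) :
  c ^+ 2 + s ^+ 2 = 1 -> c * y - s * p = 0 ->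
  y = (s * y + c * p) * s /\ p = (s * y + c * p) * c.
Proof.
move=> cs e; split.
  by rewrite -[LHS]mulr1 -cs; apply/eqP; rewrite -subr_eq0; apply/eqP;
     transitivity (c * (c * y - s * p)); [ring|rewrite e mulr0].
by rewrite -[LHS]mulr1 -cs; apply/eqP; rewrite -subr_eq0; apply/eqP;
   transitivity (- s * (c * y - s * p)); [ring|rewrite e mulr0].
Qed.

Definition angle_shoot (R : realType) (f q w : nat -> R) (l th : R) :
    nat -> R * R :=
  shoot (fun n => (f n)^-1) (fun n => q n - l * w n) (sin th, cos th).

(** The left condition fixes the initial data up to the factor [C], and the
    recursion propagates this factor.  It is nonzero since otherwise the
    eigenfunction vanishes up to the index [N.+1]; dividing by it transfers the
    right condition to the real solution. *)
Lemma eigenfunction_shoot (R : realType) (N : nat) (f q w : nat -> R)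
    (s t l : R) (z : nat -> cplx R) :
  (forall n, (n <= N)%N -> f n != 0) ->
  sl_eigenfunction N f q w (sep_class s t) l%:C z ->
  let v := angle_shoot f q w l s in
  (exists C : cplx R, forall n, (n <= N)%N ->
     z n = C * (v n).1%:C /\ quasi_diff f z n = C * (v n).2%:C) /\
  cos t * (v N).1 - sin t * (v N).2 = 0.
Proof.
move=> f0 [[m mN zm] eqn /satisfies_sep[bc0 bcN]] v.
have next n : (n <= N)%N -> z n.+1 = z n + ((f n)^-1)%:C * quasi_diff f z n.
  move=> nN; rewrite /quasi_diff mulrA -rmorphM /= mulVf ?f0 // mul1r.
  by rewrite addrC subrK.
pose C := (sin s)%:C * z 0%N + (cos s)%:C * quasi_diff f z 0.
have zE n : (n <= N)%N ->
    z n = C * (v n).1%:C /\ quasi_diff f z n = C * (v n).2%:C.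
  elim: n => [_|n IH nN].
    apply: proportional_to_angle => //.
    by rewrite -!rmorphXn -rmorphD /= cos2Dsin2.
  have [zn pn] := IH (ltnW nN).
  have zn1 : z n.+1 = C * (v n.+1).1%:C.
    rewrite next ?(ltnW nN) // zn pn /v /angle_shoot /=.
    case: (shoot _ _ _ n) => u p /=.
    by rewrite rmorphD rmorphM /= mulrDr mulrCA.
  split=> //.
  have -> : quasi_diff f z n.+1 =
      quasi_diff f z n + ((q n.+1)%:C - l%:C * (w n.+1)%:C) * z n.+1.
    have := eqn n.+1; rewrite /= nN => /(_ isT) e.
    rewrite mulrBl -e; ring.
  rewrite zn1 pn /v /angle_shoot /=.
  case: (shoot _ _ _ n) => u p /=.
  rewrite !(rmorphD, rmorphB, rmorphM, rmorphN) /=; ring.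
have C0 : C != 0.
  apply: contraNneq zm => C0.
  have z0 n : (n <= N)%N -> z n = 0 /\ quasi_diff f z n = 0.
    by move=> /zE[-> ->]; rewrite C0 !mul0r.
  move: mN; rewrite leq_eqVlt => /orP[/eqP ->|].
    by have [zN pN] := z0 N (leqnn N); rewrite next // zN pN mulr0 addr0.
  by rewrite ltnS => /z0[->].
split; first by exists C.
have [zN pN] := zE N (leqnn N).
move: bcN; rewrite zN pN mulrCA [_ * (C * _)]mulrCA -mulrBr => /eqP.
rewrite mulf_eq0 (negPf C0) /= -!rmorphM -rmorphB /=.
by move=> /eqP[].
Qed.

Lemma shoot_continuous (R : realType) (g : nat -> R) (c : nat -> R -> R)
    (a b : R -> R) (x : R) :
  (forall n, {for x, continuous (c n)}) ->
  {for x, continuous a} -> {for x, continuous b} ->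
  forall n,
    {for x, continuous (fun z => (shoot g (c^~ z) (a z, b z) n).1)} /\
    {for x, continuous (fun z => (shoot g (c^~ z) (a z, b z) n).2)}.
Proof.
move=> cc ca cb; elim=> [//|n [IH1 IH2]].
have E z : shoot g (c^~ z) (a z, b z) n.+1 =
    let v := shoot g (c^~ z) (a z, b z) n in
    (v.1 + g n * v.2, v.2 + c n.+1 z * (v.1 + g n * v.2)).
  by rewrite /=; case: (shoot _ _ _ n).
have c1 : {for x, continuous (fun z => (shoot g (c^~ z) (a z, b z) n.+1).1)}.
  rewrite (_ : (fun z => _) = (fun z => (shoot g (c^~ z) (a z, b z) n).1 +
     g n * (shoot g (c^~ z) (a z, b z) n).2)); last first.
    by apply/funext => z; rewrite E.
  by apply: continuousD => //; apply: continuousM => //; exact: cvg_cst.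
split=> //.
have -> : (fun z => (shoot g (c^~ z) (a z, b z) n.+1).2) =
    (fun z => (shoot g (c^~ z) (a z, b z) n).2 +
       c n.+1 z * (shoot g (c^~ z) (a z, b z) n.+1).1).
  by apply/funext => z; rewrite !E.
by apply: continuousD => //; apply: continuousM.
Qed.

(** * Derivatives *)

(** Since [g x = 0], the difference quotient of the product is [k] times the
    one of [g]. *)
Lemma is_derive_mul_vanishing (R : realType) (k g : R -> R) (x dg : R) :
  {for x, continuous k} -> g x = 0 -> is_derive x 1 g dg ->
  is_derive x 1 (fun z => k z * g z) (k x * dg).
Proof.
move=> ck gx [dvg gE].
suff H : (fun h : R => h^-1 *:
    (((fun z => k z * g z) \o shift x) (h *: 1) - k x * g x))
    @ 0^' --> k x * dg.
  by apply: DeriveDef; [apply/cvg_ex; exists (k x * dg)|exact: cvg_lim].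
rewrite (_ : (fun h : R => _) = (fun h : R =>
    (k (h + x)) * (h^-1 *: ((g \o shift x) (h *: 1) - g x)))); last first.
  apply/funext => h /=; rewrite gx mulr0 !subr0 /GRing.scale /= mulr1; ring.
apply: cvgM; last by rewrite -gE; exact: dvg.
apply: cvg_within_filter.
have : (fun h : R => k (h + x)) @ 0 --> k (0 + x).
  apply: (@continuous_comp _ _ _ (fun h : R => h + x) k).
    by apply: cvgD; [exact: cvg_id|exact: cvg_cst].
  by rewrite add0r.
by rewrite add0r.
Qed.

Lemma is_derive_sin_increment (R : realType) (r : R -> R) (x dr : R) :
  is_derive x 1 r dr -> is_derive x 1 (fun z => sin (r z - r x)) dr.
Proof.
move=> hr; have hd : is_derive x 1 (fun z => r z - r x) dr.
  by rewrite -[dr]subr0; apply: is_deriveB.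
have := @is_derive1_comp _ sin (fun z => r z - r x) _ _ _
  (is_derive_sin (r x - r x)) hd.
by rewrite subrr cos0 mul1r.
Qed.

(** * The eigenvalue branch *)

Lemma branch_continuous (R : realType) (N : nat) (f q w : nat -> R)
    (S0 : sep_bc R) (lam : cplx R) (U : set (sep_bc R)) (L : sep_bc R -> R) :
  sl_eigenvalue_branch N f q w S0 lam U L -> {for S0, continuous L}.
Proof.
move=> [nU _ cL _ _].
by have := cL S0; rewrite /continuous_at -(nbhs_subspace_interior nU).
Qed.

(** Varying both angles along a path treats the two ends by a single
    comparison of solutions. *)
Lemma branch_derivative_along (R : realType) (N : nat) (f q w : nat -> R)
    (lam : cplx R) (y : nat -> cplx R) (U : set (sep_bc R))
    (L : sep_bc R -> R) (s t : R -> R) (x ds dt : R) :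
  (forall n, (n <= N)%N -> f n != 0) ->
  sl_eigenfunction N f q w (sep_class (s x) (t x)) lam y ->
  normalized N w y ->
  sl_eigenvalue_branch N f q w (sep (s x) (t x)) lam U L ->
  is_derive x 1 s ds -> is_derive x 1 t dt ->
  is_derive x 1 (fun z => L (sep (s z) (t z)))
    (dt * (Normc.normc (y N) ^+ 2 + Normc.normc (quasi_diff f y N) ^+ 2) -
     ds * (Normc.normc (y 0%N) ^+ 2 + Normc.normc (quasi_diff f y 0) ^+ 2)).
Proof.
move=> f0 hy hnorm hL hs ht.
have cs : {for x, continuous s}.
  by apply: differentiable_continuous; apply/derivable1_diffP; case: hs.
have ct : {for x, continuous t}.
  by apply: differentiable_continuous; apply/derivable1_diffP; case: ht.
have csep := sep_continuous_along cs ct.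
pose M z := L (sep (s z) (t z)).
have cM : {for x, continuous M}.
  exact: (continuous_comp csep (branch_continuous hL)).
have [nU _ _ Mx eigU] := hL.
pose v z := angle_shoot f q w (M z) (s z).
have [[C yE] bcx] := eigenfunction_shoot f0
  (eq_rect_r (fun l => sl_eigenfunction N f q w _ l y) hy Mx).
rewrite -/(v x) in yE bcx.
have bcz : \forall z \near x, cos (t z) * (v z N).1 - sin (t z) * (v z N).2 = 0.
  have : \forall z \near x, U (sep (s z) (t z)) by exact: csep.
  apply: filterS => z Uz; have [y' hy'] := eigU _ Uz.
  by case: (eigenfunction_shoot f0 hy').
have cv n : {for x, continuous (fun z => (v z n).1)} /\
            {for x, continuous (fun z => (v z n).2)}.
  apply: shoot_continuous.
  - move=> k; apply: continuousB; first exact: cvg_cst.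
    by apply: continuousM => //; exact: cvg_cst.
  - by apply: continuous_comp => //; exact: continuous_sin.
  - by apply: continuous_comp => //; exact: continuous_cos.
pose sigma z := \sum_(1 <= k < N.+1) w k * (v x k).1 * (v z k).1.
pose d z := sin (t z) * (v z N).1 + cos (t z) * (v z N).2.
have csigma : {for x, continuous sigma}.
  rewrite /sigma; elim: (index_iota 1 N.+1) => [|k r IH].
    rewrite (_ : (fun z => _) = fun=> 0); first exact: cvg_cst.
    by apply/funext => z; rewrite big_nil.
  rewrite (_ : (fun z => _) = (fun z => w k * (v x k).1 * (v z k).1 +
    \sum_(j <- r) w j * (v x j).1 * (v z j).1)); last first.
    by apply/funext => z; rewrite big_cons.
  apply: continuousD => //; apply: continuousM; first exact: cvg_cst.
  by case: (cv k).
have cd : {for x, continuous d}.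
  have [c1 c2] := cv N.
  apply: continuousD; apply: continuousM => //.
    by apply: continuous_comp => //; exact: continuous_sin.
  by apply: continuous_comp => //; exact: continuous_cos.
have angleN z : cos (t z) * (v z N).1 - sin (t z) * (v z N).2 = 0 ->
    (v z N).1 = d z * sin (t z) /\ (v z N).2 = d z * cos (t z).
  exact: proportional_to_angle (cos2Dsin2 _).
have [ux px] := angleN _ bcx.
have lagrange z : cos (t z) * (v z N).1 - sin (t z) * (v z N).2 = 0 ->
    (M z - M x) * sigma z = d x * d z * sin (t z - t x) - sin (s z - s x).
  move=> bc.
  have [uz pz] := angleN _ bc.
  have := lagrange_identity (fun n => (f n)^-1) (fun n => q n - M x * w n)
    (fun n => q n - M z * w n) (sin (s x), cos (s x)) (sin (s z), cos (s z)) N.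
  rewrite -!/(angle_shoot _ _ _ _ _) -/(v x) -/(v z).
  rewrite (eq_bigr (fun k => (M x - M z) * (w k * (v x k).1 * (v z k).1)));
    last by move=> k _; rewrite /v /angle_shoot; ring.
  rewrite -mulr_sumr -/(sigma z) /casoratian /= ux px uz pz !sinB.
  by move=> e; lra.
pose K := Normc.normc C ^+ 2.
have normcE (r : R) : Normc.normc (C * r%:C) ^+ 2 = K * r ^+ 2.
  rewrite Normc.normcM exprMn /Normc.normc /= expr0n addr0.
  by rewrite sqr_sqrtr ?sqr_ge0.
have Ksigma : K * sigma x = 1.
  rewrite -hnorm mulr_sumr; apply: eq_big_nat => k /andP[_ kN].
  by have [-> _] := yE k kN; rewrite normcE; ring.
have sx0 : sigma x != 0.
  by apply: contra_eq_neq Ksigma => ->; rewrite mulr0 eq_sym oner_neq0.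
have KE : K = (sigma x)^-1.
  by rewrite -[LHS]mulr1 -(mulfV sx0) mulrA Ksigma mul1r.
pose G z := M x + ((d x * d z / sigma z) * sin (t z - t x) -
                   (sigma z)^-1 * sin (s z - s x)).
(* [lagrange] divided by [sigma z], which stays nonzero near [x] *)
have GM : \forall z \near x, G z = M z.
  have sz0 : \forall z \near x, sigma z != 0.
    exact: (@cvgr_neq0 _ _ _ _ _ sigma (sigma x) csigma sx0).
  near=> z.
  have sz : sigma z != 0 by near: z.
  have /lagrange e : cos (t z) * (v z N).1 - sin (t z) * (v z N).2 = 0.
    by near: z.
  rewrite /G -[RHS](subrK (M x)) -[M z - M x](mulfK sz) e; ring.
apply: (near_eq_is_derive (f := G)); first exact: GM.
have csigmaV : {for x, continuous (fun z => (sigma z)^-1)} by apply: cvgV.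
have -> : dt * (Normc.normc (y N) ^+ 2 + Normc.normc (quasi_diff f y N) ^+ 2) -
    ds * (Normc.normc (y 0%N) ^+ 2 + Normc.normc (quasi_diff f y 0) ^+ 2) =
   0 + ((d x * d x / sigma x) * dt - (sigma x)^-1 * ds).
  have [-> ->] := yE N (leqnn N); have [-> ->] := yE 0%N (leq0n N).
  rewrite !normcE ux px -KE -!mulrDr !exprMn -mulrDr.
  rewrite [sin _ ^+ 2 + _]addrC cos2Dsin2 /= [sin _ ^+ 2 + _]addrC cos2Dsin2.
  by ring.
apply: is_deriveD; apply: is_deriveB.
  apply: (@is_derive_mul_vanishing _ (fun z => d x * d z / sigma z)).
  - by apply: continuousM => //; apply: continuousM => //; exact: cvg_cst.
  - by rewrite subrr sin0.
  - exact: is_derive_sin_increment.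
apply: (@is_derive_mul_vanishing _ (fun z => (sigma z)^-1)) => //.
  by rewrite subrr sin0.
exact: is_derive_sin_increment.
Unshelve. all: by end_near.
Qed.

Theorem theorem4p3 (R : realType) (N : nat) (f q w : nat -> R) (a b : R)
    (lam : cplx R) (y : nat -> cplx R) (U : set (sep_bc R))
    (L : sep_bc R -> R)
    (hN : (2 <= N)%N)
    (hw : self_adjoint_coeffs N f q w)
    (hlam : sl_eigenvalue N f q w (sep_class a b) lam)
    (hy : sl_eigenfunction N f q w (sep_class a b) lam y)
    (hnorm : normalized N w y)
    (hL : sl_eigenvalue_branch N f q w (sep a b) lam U L) :
  is_derive a 1 (fun t : R => L (sep t b))
    (- Normc.normc (y 0%N) ^+ 2 - Normc.normc (quasi_diff f y 0) ^+ 2) /\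
  is_derive b 1 (fun t : R => L (sep a t))
    (Normc.normc (y N) ^+ 2 + Normc.normc (quasi_diff f y N) ^+ 2).
Proof.
have [f0 _] := hw; split.
  have := @branch_derivative_along _ _ _ _ _ _ _ _ _ id (fun=> b) a 1 0 f0 hy
    hnorm hL (is_derive_id _ _) (is_derive_cst _ _ _).
  by rewrite mul0r sub0r mul1r opprD.
have := @branch_derivative_along _ _ _ _ _ _ _ _ _ (fun=> a) id b 0 1 f0 hy
  hnorm hL (is_derive_cst _ _ _) (is_derive_id _ _).
by rewrite mul0r subr0 mul1r.
Qed.
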